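(* Let $A$ be an $n\times n$ nonsingular totally nonnegative matrix. Then $A^\vee$ is nonsingular and totally nonnegative, and $(A^\vee)^\vee=A$. Moreover, $A$ is oscillatory if and only if $A^\vee$ is oscillatory. If these conditions hold, then $$e_k(A^\vee)=e_{n-k}(A)\quad(1\le k<n),\qquad e_n(A^\vee)=e_n(A)=1,$$ and consequently $e(A^\vee)=e(A)$.
   Context: All matrices are real and have order $n\ge2$. A matrix is totally nonnegative (TN) if all its minors are $\ge0$ and totally positive (TP) if all its minors are $>0$; a square TN matrix is oscillatory if some positive power of it is TP. For a nonsingular $n\times n$ matrix $A$, its checkerboard inverse is $A^\vee=DA^{-1}D$, where $D=\operatorname{diag}(1,-1,1,-1,\dots)$, i.e. $D_{ii}=(-1)^{i-1}$. For an oscillatory matrix $A$, $e(A)=\min\{m\ge1:A^m\text{ is TP}\}$ and, for $1\le k\le n$, $e_k(A)=\min\{m\ge1:\text{all minors of order }k\text{ of }A^m\text{ are positive}\}$. *)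

(* Defs.v *)
From mathcomp Require Import all_boot all_order all_algebra.
From mathcomp Require Import boolp reals.

Set Implicit Arguments.
Unset Strict Implicit.
Unset Printing Implicit Defensive.

Import Order.TTheory GRing.Theory Num.Theory.
Local Open Scope ring_scope.

Definition increasing (k n : nat) (f : 'I_k -> 'I_n) : Prop :=
  forall i j : 'I_k, (i < j)%N -> (f i < f j)%N.

Definition minor (R : realType) (n k : nat) (A : 'M[R]_n)
    (f g : 'I_k -> 'I_n) : R :=
  \det (mxsub f g A).

Definition minors_nonneg (R : realType) (n k : nat) (A : 'M[R]_n) : Prop :=
  forall f g : 'I_k -> 'I_n, increasing f -> increasing g -> 0 <= minor A f g.

Definition minors_pos (R : realType) (n k : nat) (A : 'M[R]_n) : Prop :=
  forall f g : 'I_k -> 'I_n, increasing f -> increasing g -> 0 < minor A f g.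

Definition totally_nonnegative (R : realType) (n : nat) (A : 'M[R]_n) : Prop :=
  forall k : nat, (1 <= k <= n)%N -> minors_nonneg k A.

Definition totally_positive (R : realType) (n : nat) (A : 'M[R]_n) : Prop :=
  forall k : nat, (1 <= k <= n)%N -> minors_pos k A.

Definition oscillatory (R : realType) (n : nat) (A : 'M[R]_n) : Prop :=
  totally_nonnegative A /\
  exists m : nat, (1 <= m)%N /\ totally_positive (A ^+ m).

(* Indices start at 0, so the sign (-1)^(i-1) of 1-based indexing is (-1)^i. *)
Definition checkerboard (R : realType) (n : nat) : 'M[R]_n :=
  diag_mx (\row_(i < n) (-1) ^+ i).

Definition checkerboard_inv (R : realType) (n : nat) (A : 'M[R]_n) : 'M[R]_n :=
  checkerboard R n *m invmx A *m checkerboard R n.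

(* The least m >= 1 satisfying P, with the junk value 0 if there is none. *)
Definition least_pos (P : nat -> Prop) : nat :=
  if pselect (exists m : nat, (1 <= m)%N && `[< P m >]) is left exP
  then ex_minn exP else 0%N.

Lemma least_posP (P : nat -> Prop) (m : nat) : (1 <= m)%N -> P m ->
  [/\ (1 <= least_pos P)%N, P (least_pos P) &
      forall j : nat, (1 <= j)%N -> P j -> (least_pos P <= j)%N].
Proof.
move=> m_gt0 Pm; rewrite /least_pos.
case: pselect => [exP|[]]; last by exists m; rewrite m_gt0; apply/asboolP.
case: ex_minnP => i /andP[i_gt0 /asboolP Pi] min_i; split=> // j j_gt0 Pj.
by apply: min_i; rewrite j_gt0; apply/asboolP.
Qed.

Definition exponent (R : realType) (n : nat) (A : 'M[R]_n) : nat :=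
  least_pos (fun m => totally_positive (A ^+ m)).

Definition exponent_order (R : realType) (n k : nat) (A : 'M[R]_n) : nat :=
  least_pos (fun m => minors_pos k (A ^+ m)).

(* Main.v *)
Require Import Defs.
From mathcomp Require Import all_boot all_order all_algebra all_fingroup.
From mathcomp Require Import boolp reals ring.

Import Order.TTheory GRing.Theory Num.Theory.
Local Open Scope ring_scope.

(** The theorem rests on Jacobi's identity for the minors of an inverse.  Let
    [f, g] be increasing choices of [k] indices out of [n] and [f', g'] the
    increasing enumerations of their complements.  Jacobi's identity says that
    the minor of [A^-1] on rows [f] and columns [g], multiplied by [\det A], is
    the minor of [A] on rows [g'] and columns [f'], up to the sign
    [(-1) ^ (sum of the f i + sum of the g i)].  Conjugation by the checkerboard
    matrix multiplies the minor by exactly that sign, so that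
    [det_mul_minor_checkerboard_inv] is free of signs:
      [\det A * minor A^v f g = minor A g' f'].

    The identity has two ingredients.  One is the unsigned block version
    [det_mulmx1_ulsub]: if [M *m N = 1], then [\det M] times the upper left
    corner minor of [N] is the lower right corner minor of [M].  It is applied
    to [A] after moving the rows [g] and the columns [f] to the front.  The
    other is the sign of the permutations that do so
    ([sign_block_increasing]): a permutation of [k + l] indices that is
    increasing on the first [k] and on the last [l] is a shuffle, and its sign
    is [(-1)] to the power [\sum_(i < k) (s i + i)].

    A nonsingular totally nonnegative [A] has positive determinant, so the
    minors of order [k] of [A^v] are all nonnegative (positive) as soon as those
    of order [n - k] of [A] are, where the minor of order [0] is [1].  This is
    an equivalence, since [A |-> A^v] is an involution.  Moreover
    [(A ^ m)^v = (A^v) ^ m] although [A |-> A^v] reverses products, so the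
    equivalence applies to all powers, and the sets of exponents whose minima
    define the two sides of each equality coincide. *)

(** * Signs of shuffles *)

(** Splitting off the value at the first index; this makes induction on the size
    of a permutation possible, with [odd_lift_perm] giving the sign. *)
Lemma lift_perm_unlift n (s : 'S_n.+1) :
  exists t : 'S_n, s = lift_perm ord0 (s ord0) t.
Proof.
set j := s ord0.
(* Composing with the inverse of [lift_perm ord0 j 1] gives a permutation that
   fixes [ord0], and it can be restricted to the other indices. *)
have fixs0 : (s * lift_perm j ord0 1)%g ord0 = ord0.
  by rewrite permM lift_perm_id.
set u := (s * _)%g in fixs0.
have u_neq0 i : u ord0 != u (lift ord0 i).
  by rewrite (inj_eq perm_inj) neq_lift.
pose t_fun i := odflt i (unlift ord0 (u (lift ord0 i))).
have t_funE i : lift ord0 (t_fun i) = u (lift ord0 i).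
  rewrite /t_fun; case: unliftP => [i' -> //|u0].
  by have := u_neq0 i; rewrite fixs0 u0 eqxx.
have t_inj : injective t_fun.
  move=> i i' eq_t; have := t_funE i; rewrite eq_t t_funE.
  by move/perm_inj/lift_inj.
exists (perm t_inj).
have -> : s = (u * lift_perm ord0 j 1)%g.
  by rewrite /u -mulgA lift_permM mulg1 lift_perm1 mulg1.
rewrite -[perm t_inj]mulg1 -(lift_permM _ ord0); congr (_ * _)%g.
apply/permP=> i; case: (unliftP ord0 i) => [i'|] ->.
  by rewrite [RHS]lift_perm_lift (permE t_inj) t_funE.
by rewrite [RHS]lift_perm_id.
Qed.

(** By induction on [n]: removing the index [ord0] and its value lowers [k] by
    one.  For [k > 0] the value [s ord0] is below every other [s i] with
    [i < k], so that both [i] and [s i] drop by one and no parity changes;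
    [ord0] itself contributes [s ord0].  For [k = 0] the permutation is
    increasing, hence
    fixes [ord0], and both sides are [1]. *)
Lemma sign_block_increasing (R : comPzRingType) n k (s : 'S_n) :
    (forall i j : 'I_n, (i < j)%N -> (i < k)%N = (j < k)%N -> (s i < s j)%N) ->
  (-1) ^+ s = \prod_(i < n | (i < k)%N) (-1) ^+ (s i + i) :> R.
Proof.
elim: n k s => [|n IHn] k s inc_s.
  by rewrite permS0 odd_perm1 big_ord0.
have [t Ds] := lift_perm_unlift n s.
have sL i : s (lift ord0 i) = lift (s ord0) (t i).
  by rewrite {1}Ds lift_perm_lift.
have inc_t (i j : 'I_n) : (i < j)%N -> (i < k.-1)%N = (j < k.-1)%N ->
    (t i < t j)%N.
  move=> lt_ij eq_k; have := inc_s (lift ord0 i) (lift ord0 j).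
  rewrite !sL /= /bump /= !add1n ltnS => /(_ lt_ij).
  have -> : (i.+1 < k)%N = (j.+1 < k)%N by case: (k) eq_k.
  move/(_ erefl); rewrite !ltnNge; apply: contra => le_t.
  by rewrite leq_add //; case: (leqP _ (t j)) => // /leq_trans->.
rewrite Ds odd_lift_perm -Ds signr_addb (IHn _ _ inc_t) addFb signr_odd.
rewrite big_mkcond [RHS]big_mkcond big_ord_recl /=.
case: k inc_s {inc_t} => [|k] inc_s /=.
  (* Otherwise [s ord0] would be below the value [ord0] of a later index. *)
  rewrite [s ord0](_ : _ = ord0) ?expr0; last first.
    pose j := (s^-1)%g ord0; case: (unliftP ord0 j) => [j' Dj|Dj].
      have := inc_s ord0 j; rewrite permKV ltn0 Dj => /(_ isT) /=.
      by rewrite ltn0 => /(_ erefl).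
    by rewrite -{1}Dj permKV.
  by congr (_ * _); apply: eq_bigr.
rewrite addn0; congr (_ * _); apply: eq_bigr => i _.
rewrite -[bump 0 i]/i.+1 ltnS; case: ifP => // lt_ik.
have : (s ord0 < s (lift ord0 i))%N.
  by apply: inc_s => //; rewrite lift0 !ltnS lt_ik.
rewrite sL /= /bump; case: (leqP _ (t i)) => [_ _|lt_t].
  by rewrite add1n addnS addSn !exprS mulrA mulrNN !mul1r.
by rewrite ltnNge ltnW.
Qed.

(** A permutation of this form encodes the index set [f] together with the
    increasing enumeration of its complement. *)
Lemma complement_increasing k l (f : 'I_k -> 'I_(k + l)) : increasing f ->
  exists s : 'S_(k + l),
    (forall i, s (lshift l i) = f i) /\ increasing (fun j => s (rshift k j)).
Proof.
move=> inc_f.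
have inj_f : injective f.
  move=> i j eq_f; apply: val_inj => /=.
  by case: (ltngtP i j) => // /inc_f; rewrite eq_f ltnn.
pose C := ~: [set f i | i : 'I_k].
have cardC : l = #|C|.
  apply: (@addnI k); rewrite -[in LHS](card_ord (k + l)).
  by rewrite -(cardsC [set f i | i : 'I_k]) card_imset // card_ord.
pose g (j : 'I_l) := Order.enum_val (cast_ord cardC j).
have inc_g : increasing g.
  move=> i j lt_ij; change (g i < g j)%O.
  rewrite ltNge Order.EnumVal.le_enum_val; last exact: le_total.
  by rewrite leEord -ltnNge.
pose h i := match split i with inl i' => f i' | inr j => g j end.
have inj_g : injective g.
  move=> i j eq_g; apply: val_inj => /=.
  by case: (ltngtP i j) => // /inc_g; rewrite eq_g ltnn.
have fDg i j : f i <> g j.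
  move=> eq_fg; have : g j \in C by apply: Order.EnumVal.enum_valP.
  by rewrite inE -eq_fg imset_f.
have inj_h : injective h.
  move=> i j; rewrite /h -{2}[i]splitK -{2}[j]splitK.
  case: (split i) (split j) => [i'|i'] [j'|j'].
  - by move/inj_f->.
  - by move/fDg.
  - by move/esym/fDg.
  - by move/inj_g->.
have hl i : h (lshift l i) = f i.
  by rewrite /h -[lshift l i]/(unsplit (inl i)) unsplitK.
have hr j : h (rshift k j) = g j.
  by rewrite /h -[rshift k j]/(unsplit (inr j)) unsplitK.
exists (perm inj_h); split=> [i|i j lt_ij]; rewrite !permE ?hl // !hr.
exact: inc_g.
Qed.

Lemma sign_shuffle (R : comPzRingType) k l (s : 'S_(k + l)) :
    increasing (fun i => s (lshift l i)) ->
    increasing (fun j => s (rshift k j)) ->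
  (-1) ^+ s = \prod_(i < k) (-1) ^+ (s (lshift l i) + i) :> R.
Proof.
move=> inc_l inc_r; rewrite (@sign_block_increasing _ _ k) => [|i j].
  rewrite big_mkcond big_split_ord /= [X in _ * X]big1 ?mulr1 => [|j _].
    by apply: eq_bigr => i _; rewrite ltn_ord.
  by rewrite ltnNge leq_addr.
case: (split_ordP i) => i' ->; case: (split_ordP j) => j' -> /=.
- by move=> lt_ij _; apply: inc_l.
- by [].
- by [].
- by rewrite ltn_add2l => lt_ij _; apply: inc_r.
Qed.

(** * Complementary minors of the checkerboard inverse *)

(** Jacobi's identity for corner minors.  Replace the right block column
    of [N] by that of the identity: the product of [M] with this matrix has the
    left block column of the identity and the right block column of [M].  Both
    are block triangular, with the two corner minors as determinants. *)
Lemma det_mulmx1_ulsub (R : comPzRingType) k l (M N : 'M[R]_(k + l)) :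
  M *m N = 1%:M -> \det M * \det (ulsubmx N) = \det (drsubmx M).
Proof.
move=> MN1; have -> : \det (ulsubmx N) =
  \det (block_mx (ulsubmx N) 0 (dlsubmx N) 1%:M).
  by rewrite det_lblock det1 mulr1.
have -> : \det (drsubmx M) = \det (block_mx 1%:M (ursubmx M) 0 (drsubmx M)).
  by rewrite det_ublock det1 mul1r.
rewrite -det_mulmx -[M in LHS]submxK mulmx_block !mulmx0 !mulmx1 !add0r.
move: MN1; rewrite -{1}[M]submxK -{1}[N]submxK mulmx_block scalar_mx_block.
by case/eq_block_mx=> -> _ -> _.
Qed.

Lemma checkerboardK (R : realType) n :
  checkerboard R n *m checkerboard R n = 1%:M.
Proof.
rewrite mulmx_diag -[RHS]diag_const_mx; congr diag_mx.
by apply/rowP=> i; rewrite !mxE -exprMn mulrNN mulr1 expr1n.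
Qed.

Lemma checkerboard_invE (R : realType) n (A : 'M[R]_n) i j :
  checkerboard_inv A i j = (-1) ^+ i * invmx A i j * (-1) ^+ j.
Proof. by rewrite /checkerboard_inv mul_mx_diag mul_diag_mx !mxE. Qed.

Lemma minor_checkerboard_inv (R : realType) n k (A : 'M[R]_n)
    (f g : 'I_k -> 'I_n) :
  minor (checkerboard_inv A) f g =
  (\prod_i (-1) ^+ f i) * minor (invmx A) f g * (\prod_i (-1) ^+ g i).
Proof.
pose sg h := \row_(i < k) (-1) ^+ (h i : 'I_n) : 'rV[R]_k.
have -> : minor (checkerboard_inv A) f g =
    \det (diag_mx (sg f) *m mxsub f g (invmx A) *m diag_mx (sg g)).
  congr (\det _); apply/matrixP=> i j.
  by rewrite mul_mx_diag mul_diag_mx [LHS]mxE checkerboard_invE !mxE.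
by rewrite !det_mulmx !det_diag; congr (_ * _ * _); apply: eq_bigr => i _;
  rewrite mxE.
Qed.

(** The checkerboard signs [(-1) ^ f i] and [(-1) ^ g i] cancel against the
    signs of the shuffles that bring [f] and [g] to the front; the remaining
    part [\prod_(i < k) (-1) ^ i] of each shuffle sign is common to both and
    squares to [1]. *)
Lemma det_mul_minor_checkerboard_inv (R : realType) n k (A : 'M[R]_n)
    (f g : 'I_k -> 'I_n) :
    A \in unitmx -> (k <= n)%N -> increasing f -> increasing g ->
  exists f' g' : 'I_(n - k) -> 'I_n, [/\ increasing f', increasing g' &
    \det A * minor (checkerboard_inv A) f g = minor A g' f'].
Proof.
move=> uA le_kn; move: (n - k)%N (subnKC le_kn) => l Dn.
case: n / Dn A f g uA {le_kn} => A f g uA inc_f inc_g.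
have [s [sf inc_s]] := complement_increasing _ _ _ inc_f.
have [t [tg inc_t]] := complement_increasing _ _ _ inc_g.
exists (fun j => s (rshift k j)), (fun j => t (rshift k j)); split=> //.
have signE (u : 'S_(k + l)) h : (forall i, u (lshift l i) = h i) ->
    increasing h -> increasing (fun j => u (rshift k j)) ->
  (-1) ^+ u = \prod_i (-1) ^+ h i * \prod_(i < k) (-1) ^+ i :> R.
  move=> uh inc_h inc_u; rewrite sign_shuffle // => [|i j /inc_h].
    by rewrite -big_split; apply: eq_bigr => i _; rewrite exprD uh.
  by rewrite !uh.
have MN1 : mxsub t s A *m mxsub s t (invmx A) = 1%:M.
  rewrite -[mxsub t s A]mulmx1 -mulmxA.
  apply/matrixP=> i j; rewrite mul1mx !mxE.
  have /matrixP/(_ (t i) (t j)) := mulmxV uA.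
  rewrite !mxE (inj_eq perm_inj) => <-.
  by rewrite [RHS](reindex_inj (@perm_inj _ s)); apply: eq_bigr => a _;
    rewrite !mxE.
have detM : \det (mxsub t s A) = (-1) ^+ t * \det A * (-1) ^+ s.
  have -> : mxsub t s A = perm_mx t *m A *m perm_mx s^-1.
    by rewrite -row_permE -col_permE; apply/matrixP=> i j; rewrite !mxE.
  by rewrite !det_mulmx !det_perm odd_permV.
have := det_mulmx1_ulsub _ _ _ _ _ MN1.
have -> : ulsubmx (mxsub s t (invmx A)) = mxsub f g (invmx A).
  by apply/matrixP=> i j; rewrite !mxE sf tg.
have -> : drsubmx (mxsub t s A) =
    mxsub (fun j => t (rshift k j)) (fun j => s (rshift k j)) A.
  by apply/matrixP=> i j; rewrite !mxE.
rewrite detM.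
rewrite minor_checkerboard_inv (signE s f) // (signE t g) // /minor => <-.
set c := \prod_(i < k) _.
have cc : c * c = 1.
  by rewrite -big_split big1 //= => i _; rewrite -expr2 sqrr_sign.
set x := \prod_i _; set y := \prod_i _.
by rewrite -[LHS]mulr1 -cc; ring.
Qed.

(** * Algebra of the checkerboard inverse *)

Lemma det_checkerboard_inv (R : realType) n (A : 'M[R]_n) :
  \det (checkerboard_inv A) = (\det A)^-1.
Proof.
rewrite /checkerboard_inv !det_mulmx det_inv mulrAC -det_mulmx.
by rewrite checkerboardK det1 mul1r.
Qed.

Lemma checkerboard_inv_unit (R : realType) n (A : 'M[R]_n) :
  A \in unitmx -> checkerboard_inv A \in unitmx.
Proof. by rewrite !unitmxE det_checkerboard_inv unitrV. Qed.

(** Uniqueness of the inverse, in the form in which the algebraic properties of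
    the checkerboard inverse are checked below. *)
Lemma checkerboard_inv_eq (R : realType) n (A B : 'M[R]_n) :
    A \in unitmx -> A *m (checkerboard R n *m B *m checkerboard R n) = 1%:M ->
  checkerboard_inv A = B.
Proof.
move=> uA /(congr1 (mulmx (invmx A))); rewrite mulmx1 mulKmx // => DBD.
rewrite /checkerboard_inv -DBD !mulmxA checkerboardK mul1mx.
by rewrite -mulmxA checkerboardK mulmx1.
Qed.

Lemma checkerboard_invK (R : realType) n (A : 'M[R]_n) :
  A \in unitmx -> checkerboard_inv (checkerboard_inv A) = A.
Proof.
move=> uA; apply: checkerboard_inv_eq; first exact: checkerboard_inv_unit.
rewrite /checkerboard_inv -!mulmxA.
rewrite (mulmxA (checkerboard R n) (checkerboard R n)).
by rewrite checkerboardK mul1mx mulKmx // checkerboardK.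
Qed.

Lemma det_exp (R : comPzRingType) n (A : 'M[R]_n) m :
  \det (A ^+ m) = \det A ^+ m.
Proof.
by elim: m => [|m IHm]; rewrite ?expr0 ?det1 // !exprS det_mulmx IHm.
Qed.

Lemma unitmxX (R : comUnitRingType) n (A : 'M[R]_n) m :
  A \in unitmx -> A ^+ m \in unitmx.
Proof. by rewrite !unitmxE det_exp; apply: unitrX. Qed.

Lemma checkerboard_invX (R : realType) n (A : 'M[R]_n) m :
  A \in unitmx -> checkerboard_inv (A ^+ m) = checkerboard_inv A ^+ m.
Proof.
move=> uA; elim: m => [|m IHm].
  apply: checkerboard_inv_eq; rewrite !expr0 ?unitmx1 //.
  by rewrite mul1mx mulmx1 checkerboardK.
have uAm := unitmxX _ _ _ m uA.
rewrite exprSr [RHS]exprS -IHm.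
apply: checkerboard_inv_eq; first by rewrite unitmx_mul uA uAm.
rewrite -mulmxE /checkerboard_inv -!mulmxA.
rewrite !(mulmxA (checkerboard R n) (checkerboard R n)) checkerboardK !mul1mx.
by rewrite mulmx1 mulKVmx // mulmxV.
Qed.

(** * Transfer of positivity *)

(** The determinant is itself a minor. *)
Lemma det_TN_gt0 (R : realType) n (A : 'M[R]_n) :
  A \in unitmx -> totally_nonnegative A -> 0 < \det A.
Proof.
rewrite unitmxE unitfE lt0r => -> TN_A /=.
case: n A TN_A => [|n] A TN_A; first by rewrite det_mx00.
have: (1 <= n.+1 <= n.+1)%N by rewrite leqnn.
move/TN_A/(_ id id (fun _ _ => id) (fun _ _ => id)).
by rewrite /minor mxsub_id.
Qed.

Lemma minors_nonneg_checkerboard_inv (R : realType) n k (A : 'M[R]_n) :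
    0 < \det A -> (k <= n)%N -> minors_nonneg (n - k) A ->
  minors_nonneg k (checkerboard_inv A).
Proof.
move=> detA le_kn Apos f g inc_f inc_g.
have uA : A \in unitmx by rewrite unitmxE unitfE gt_eqF.
have [f' [g' [inc_f' inc_g' E]]] :=
  det_mul_minor_checkerboard_inv _ _ _ _ _ _ uA le_kn inc_f inc_g.
by rewrite -(pmulr_rge0 _ detA) E Apos.
Qed.

Lemma minors_pos_checkerboard_inv (R : realType) n k (A : 'M[R]_n) :
    0 < \det A -> (k <= n)%N -> minors_pos (n - k) A ->
  minors_pos k (checkerboard_inv A).
Proof.
move=> detA le_kn Apos f g inc_f inc_g.
have uA : A \in unitmx by rewrite unitmxE unitfE gt_eqF.
have [f' [g' [inc_f' inc_g' E]]] :=
  det_mul_minor_checkerboard_inv _ _ _ _ _ _ uA le_kn inc_f inc_g.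
by rewrite -(pmulr_rgt0 _ detA) E Apos.
Qed.

Lemma minors_pos0 (R : realType) n (A : 'M[R]_n) : minors_pos 0 A.
Proof. by move=> f g _ _; rewrite /minor det_mx00. Qed.

(** The converse is the direct implication for [checkerboard_inv A], by
    involutivity. *)
Lemma minors_pos_checkerboard_invE (R : realType) n k (A : 'M[R]_n) :
    0 < \det A -> (k <= n)%N ->
  minors_pos k (checkerboard_inv A) <-> minors_pos (n - k) A.
Proof.
move=> detA le_kn; split; last exact: minors_pos_checkerboard_inv.
have uA : A \in unitmx by rewrite unitmxE unitfE gt_eqF.
rewrite -{1}(subKn le_kn) -{2}(checkerboard_invK _ _ _ uA) => Apos.
apply: minors_pos_checkerboard_inv; rewrite ?leq_subr //.
by rewrite det_checkerboard_inv invr_gt0.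
Qed.

(** The complementary order is [0], where the only minor is [1]. *)
Lemma minors_pos_full (R : realType) n (A : 'M[R]_n) :
  0 < \det A -> minors_pos n A.
Proof.
move=> detA; have uA : A \in unitmx by rewrite unitmxE unitfE gt_eqF.
rewrite -[A](checkerboard_invK _ _ _ uA); apply: minors_pos_checkerboard_inv => //.
  by rewrite det_checkerboard_inv invr_gt0.
by rewrite subnn; apply: minors_pos0.
Qed.

(** Order [n] is apart from the others, as its complementary order [0] lies
    outside the range of orders in total nonnegativity. *)
Lemma totally_nonnegative_checkerboard_inv (R : realType) n (A : 'M[R]_n) :
  0 < \det A -> totally_nonnegative A ->
  totally_nonnegative (checkerboard_inv A).
Proof.
move=> detA TN_A k /andP[k_gt0 le_kn].
apply: minors_nonneg_checkerboard_inv => //.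
move: le_kn; rewrite leq_eqVlt => /predU1P[->|lt_kn].
  by rewrite subnn => f g _ _; rewrite /minor det_mx00 ler01.
by apply: TN_A; rewrite subn_gt0 lt_kn leq_subr.
Qed.

Lemma totally_positive_checkerboard_inv (R : realType) n (A : 'M[R]_n) :
  0 < \det A -> totally_positive A -> totally_positive (checkerboard_inv A).
Proof.
move=> detA TP_A k /andP[k_gt0 le_kn].
apply: minors_pos_checkerboard_inv => //.
move: le_kn; rewrite leq_eqVlt => /predU1P[->|lt_kn].
  by rewrite subnn; apply: minors_pos0.
by apply: TP_A; rewrite subn_gt0 lt_kn leq_subr.
Qed.

Lemma totally_positive_checkerboard_invE (R : realType) n (A : 'M[R]_n) :
  0 < \det A -> totally_positive (checkerboard_inv A) <-> totally_positive A.
Proof.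
move=> detA; split; last exact: totally_positive_checkerboard_inv.
have uA : A \in unitmx by rewrite unitmxE unitfE gt_eqF.
rewrite -{2}(checkerboard_invK _ _ _ uA).
apply: totally_positive_checkerboard_inv.
by rewrite det_checkerboard_inv invr_gt0.
Qed.

Lemma eq_least_pos (P Q : nat -> Prop) :
  (forall m, P m <-> Q m) -> least_pos P = least_pos Q.
Proof. by move=> PQ; congr least_pos; apply/funext=> m; apply/propext. Qed.

Lemma exponent_order_full (R : realType) n (A : 'M[R]_n) :
  0 < \det A -> exponent_order n A = 1%N.
Proof.
move=> detA.
have pos1 : minors_pos n (A ^+ 1) by rewrite expr1; apply: minors_pos_full.
have [e_gt0 _ min_e] :=
  @least_posP (fun m => minors_pos n (A ^+ m)) 1 isT pos1.
by apply/eqP; rewrite eqn_leq e_gt0 min_e.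
Qed.

Theorem theorem6p2 (R : realType) (n : nat) (hn : (2 <= n)%N) (A : 'M[R]_n)
    (A_nonsing : A \in unitmx) (A_TN : totally_nonnegative A) :
  [/\ checkerboard_inv A \in unitmx,
      totally_nonnegative (checkerboard_inv A),
      checkerboard_inv (checkerboard_inv A) = A,
      (oscillatory A <-> oscillatory (checkerboard_inv A)) &
      (oscillatory A ->
       [/\ (forall k : nat, (1 <= k < n)%N ->
              exponent_order k (checkerboard_inv A) =
              exponent_order (n - k) A),
           exponent_order n (checkerboard_inv A) = 1%N,
           exponent_order n A = 1%N &
           exponent (checkerboard_inv A) = exponent A])].
Proof.
have detA := det_TN_gt0 _ _ _ A_nonsing A_TN.
have detAm m : 0 < \det (A ^+ m) by rewrite det_exp exprn_gt0.
have TN_V := totally_nonnegative_checkerboard_inv _ _ _ detA A_TN.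
have TP_VX m : totally_positive (checkerboard_inv A ^+ m) <->
    totally_positive (A ^+ m).
  by rewrite -checkerboard_invX //; apply: totally_positive_checkerboard_invE.
split=> //; first exact: checkerboard_inv_unit.
- exact: checkerboard_invK.
- by split=> -[_ [m [m_gt0 TP_m]]]; split=> //; exists m; split=> //;
    apply/TP_VX.
move=> _; split.
- move=> k /andP[_ lt_kn]; apply: eq_least_pos => m.
  rewrite -checkerboard_invX //.
  exact: minors_pos_checkerboard_invE _ (ltnW lt_kn).
- by apply: exponent_order_full; rewrite det_checkerboard_inv invr_gt0.
- exact: exponent_order_full.
- exact: eq_least_pos.
Qed.
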